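(* Let $X=\{1,2,3,4\}$ be the polyhedral crossed set of the vertices of the tetrahedron and let $V=\mathbb CX$ be the braided vector space with braiding $x\otimes y\mapsto-(x\triangleright y)\otimes x$ for $x,y\in X$ (associated with the constant cocycle $-1$). The Nichols algebra $\mathfrak B(V)$ can be presented by generators $\{1,2,3,4\}$ with defining relations (juxtaposition denotes the product of generators) $$\begin{aligned}&1^2,\ 2^2,\ 3^2,\ 4^2,\\&31+23+12,\quad 41+34+13,\quad 42+21+14,\quad 43+32+24,\\&321321+213213+132132.\end{aligned}$$ A basis of $\mathfrak B(V)$ is obtained by choosing one element in each of the following rows and juxtaposing (multiplying) them from top to bottom ($e$ is the unit element of the algebra): $$\begin{aligned}&(e,1)\\&(e,2,21)\\&(e,321)\\&(e,3,32)\\&(e,4)\end{aligned}$$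
   Context: The crossed set $X$: for vertices $x_i$ of a regular tetrahedron centered at $0$, $x_i\triangleright x_j=T_i(x_j)$, where $T_i$ is the rotation fixing $x_i$ by angle $2\pi/3$ (right hand rule, thumb pointing to $x_i$). With the numbering used here, the operation is $i\triangleright j=\phi_i(j)$ with $\phi_1=(2\,3\,4)$, $\phi_2=(1\,4\,3)$, $\phi_3=(1\,2\,4)$, $\phi_4=(1\,3\,2)$ as permutations of $\{1,2,3,4\}$ in cycle notation (e.g. $1\triangleright2=3$). Nichols algebra of a braided vector space $(V,c)$: let the braid group $\mathbb B_n$ (generators $\sigma_i$) act on $V^{\otimes n}$, $\sigma_i$ by the braiding in positions $i,i+1$; for $x\in\mathbb S_n$ with shortest expression $x=\tau_{i_1}\cdots\tau_{i_l}$ in elementary transpositions put $M(x)=\sigma_{i_1}\cdots\sigma_{i_l}$; $Q_n=\sum_{x\in\mathbb S_n}M(x)$; then $\mathfrak B(V)=\mathbb C\oplus V\oplus\bigoplus_{n\ge2}V^{\otimes n}/\ker Q_n$. *)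

(* Defs.v *)
From HB Require Import structures.
From mathcomp Require Import all_boot all_order all_algebra all_fingroup.
From mathcomp Require Import generic_quotient ring_quotient finmap.
From mathcomp Require Import monalg.
From mathcomp Require Import boolp classical_sets reals.
From mathcomp Require Import complex.

Set Implicit Arguments.
Unset Strict Implicit.
Unset Printing Implicit Defensive.

Import GRing.Theory.

Local Open Scope ring_scope.
Local Open Scope quotient_scope.

(* The tensor algebra T(V) of the vector space V = KX with basis X: the free  *)
(* associative algebra on X. The words of length n form a basis of its        *)
(* component V^{(x) n}.                                                       *)
Notation "{ 'tensalg' K [ X ] }" := {malg K[{fmonom X}]}
  (at level 0, K, X at level 2, format "{ 'tensalg'  K [ X ] }").

Section TensorAlgebra.
Variables (K : fieldType) (X : choiceType).

Definition word (w : seq X) : {tensalg K[X]} := << FMonom w >>.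

Definition gen (x : X) : {tensalg K[X]} := word [:: x].

Definition linext (f : seq X -> {tensalg K[X]}) (t : {tensalg K[X]}) :
    {tensalg K[X]} :=
  \sum_(m <- msupp t) t@_m *: f m.

Lemma linext_is_linear f : linear (linext f).
Proof.
have linextE (t : {tensalg K[X]}) d : (msupp t `<=` d)%fset ->
    linext f t = \sum_(m <- d) t@_m *: f m.
  move=> sub; rewrite /linext (big_fset_incl _ sub) // => m _ /mcoeff_outdom ->.
  by rewrite scale0r.
move=> a s t; pose d := (msupp s `|` msupp t `|` msupp (a *: s + t))%fset.
have sd : (msupp s `<=` d)%fset by rewrite /d -fsetUA fsubsetUl.
have td : (msupp t `<=` d)%fset by rewrite /d fsetUAC fsubsetUr.
have ud : (msupp (a *: s + t) `<=` d)%fset by rewrite /d fsubsetUr.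
rewrite (linextE _ _ sd) (linextE _ _ td) (linextE _ _ ud).
rewrite scaler_sumr -big_split /=; apply: eq_bigr => m _.
by rewrite mcoeffD mcoeffZ scalerDl scalerA.
Qed.
HB.instance Definition _ f :=
  GRing.isLinear.Build K {tensalg K[X]} {tensalg K[X]} _ (linext f)
    (linext_is_linear f).

End TensorAlgebra.

Section ShortestExpressions.
Variable n : nat.

Lemma ltn_adj (i : 'I_n.-1) : (i.+1 < n)%N.
Proof. by rewrite -ltn_predRL. Qed.

(* The elementary transposition (i i+1); indices start at 0.                  *)
Definition adj_tperm (i : 'I_n.-1) : 'S_n :=
  tperm (Ordinal (ltnW (ltn_adj i))) (Ordinal (ltn_adj i)).

Definition expression_of (x : 'S_n) (s : seq 'I_n.-1) : Prop :=
  (\prod_(i <- s) adj_tperm i)%g = x.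

(* In mathcomp (s * t)%g applies s first, so these are the mirror images of   *)
(* the shortest expressions for the other convention, i.e. those of x^-1;     *)
(* this does not change the sum over 'S_n below.                              *)
Definition shortest_expression (x : 'S_n) (s : seq 'I_n.-1) : Prop :=
  expression_of x s /\
  forall s', expression_of x s' -> (size s <= size s')%N.

End ShortestExpressions.

Section NicholsAlgebra.
Variables (K : fieldType) (X : choiceType).

(* [c x y] is the value c(x (x) y) of the braiding on basis vectors, an       *)
(* element of degree 2 of T(V).                                               *)
Variable c : X -> X -> {tensalg K[X]}.

Definition sigma_word (i : nat) (w : seq X) : {tensalg K[X]} :=
  if drop i w is x :: y :: w' then word K (take i w) * c x y * word K w'
  else word K w.

Definition sigma (i : nat) : {tensalg K[X]} -> {tensalg K[X]} :=
  linext (sigma_word i).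

(* M(x) = sigma_{i_1} ... sigma_{i_l} as a composition of operators. The      *)
(* choice made by [xget] among the shortest expressions is immaterial.        *)
Definition braid_lift n (x : 'S_n) : {tensalg K[X]} -> {tensalg K[X]} :=
  foldr (fun (i : 'I_n.-1) f => sigma i \o f) id
    (xget [::] [set s | shortest_expression x s]%classic).

(* The sum of the Q_n over all n, acting on T(V). It preserves degrees, and   *)
(* Q_0, Q_1 are identities, so its kernel is the direct sum of the ker Q_n    *)
(* for n >= 2.                                                                *)
Definition quantum_symmetrizer : {tensalg K[X]} -> {tensalg K[X]} :=
  linext (fun w => \sum_(x : 'S_(size w)) braid_lift x (word K w)).

HB.instance Definition _ := GRing.Linear.on quantum_symmetrizer.

Definition nichols_ker : {pred {tensalg K[X]}} :=
  [pred t | quantum_symmetrizer t == 0].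

Lemma nichols_kerE t : (t \in nichols_ker) = (quantum_symmetrizer t == 0).
Proof. by []. Qed.

Lemma nichols_ker_zmod_closed : zmod_closed nichols_ker.
Proof.
split=> [|s t]; first by rewrite nichols_kerE raddf0.
rewrite !nichols_kerE => /eqP s0 /eqP t0.
by rewrite raddfB /= s0 t0 subr0.
Qed.
HB.instance Definition _ :=
  GRing.isZmodClosed.Build {tensalg K[X]} nichols_ker nichols_ker_zmod_closed.

Definition nichols : Type := Quotient.quot nichols_ker.

HB.instance Definition _ := Choice.on nichols.
HB.instance Definition _ := GRing.Zmodule.on nichols.

Definition nichols_pi (t : {tensalg K[X]}) : nichols := \pi_(Quotient.quot nichols_ker) t.

Definition nichols_repr (u : nichols) : {tensalg K[X]} :=
  repr (u : Quotient.quot nichols_ker).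

Lemma nichols_reprK : cancel nichols_repr nichols_pi.
Proof. by move=> u; apply: reprK. Qed.

Lemma nichols_pi_eq s t :
  nichols_pi s = nichols_pi t <->
  quantum_symmetrizer s = quantum_symmetrizer t.
Proof.
transitivity (s - t \in nichols_ker).
  by rewrite Quotient.idealrBE; split=> [/eqP|/eqP].
by rewrite nichols_kerE raddfB subr_eq0; split=> [/eqP|/eqP].
Qed.

Lemma nichols_piB : {morph nichols_pi : s t / s - t}.
Proof. by move=> s t; rewrite /nichols_pi raddfB. Qed.

Lemma nichols_piD : {morph nichols_pi : s t / s + t}.
Proof. by move=> s t; rewrite /nichols_pi raddfD. Qed.

Definition nichols_scale (a : K) (u : nichols) : nichols :=
  nichols_pi (a *: nichols_repr u).

Lemma nichols_piZ a t : nichols_pi (a *: t) = nichols_scale a (nichols_pi t).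
Proof.
apply/nichols_pi_eq; rewrite !linearZ /=; congr (_ *: _).
by apply/nichols_pi_eq; rewrite nichols_reprK.
Qed.

Lemma nichols_scaleA a b u :
  nichols_scale a (nichols_scale b u) = nichols_scale (a * b) u.
Proof. by rewrite -[u]nichols_reprK -!nichols_piZ scalerA. Qed.

Lemma nichols_scale1 : left_id 1 nichols_scale.
Proof. by move=> u; rewrite -[u]nichols_reprK -nichols_piZ scale1r. Qed.

Lemma nichols_scaleDr : right_distributive nichols_scale +%R.
Proof.
move=> a u v; rewrite -[u]nichols_reprK -[v]nichols_reprK -nichols_piD.
by rewrite -!nichols_piZ scalerDr nichols_piD.
Qed.

Lemma nichols_scaleDl u : {morph nichols_scale^~ u : a b / a + b}.
Proof.
by move=> a b; rewrite -[u]nichols_reprK -!nichols_piZ scalerDl nichols_piD.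
Qed.

HB.instance Definition _ := GRing.Zmodule_isLmodule.Build K nichols
  nichols_scaleA nichols_scale1 nichols_scaleDr nichols_scaleDl.

Lemma nichols_pi_is_linear : linear nichols_pi.
Proof. by move=> a s t; rewrite nichols_piD nichols_piZ. Qed.
HB.instance Definition _ :=
  GRing.isLinear.Build K {tensalg K[X]} nichols _ nichols_pi
    nichols_pi_is_linear.

(* The product induced by that of T(V). It is independent of representatives  *)
(* exactly when [nichols_pi] is multiplicative.                               *)
Definition nichols_mul (u v : nichols) : nichols :=
  nichols_pi (nichols_repr u * nichols_repr v).

End NicholsAlgebra.

Definition in_ideal_gen (A : pzRingType) (S : seq A) (t : A) : Prop :=
  exists (n : nat) (a r b : 'I_n -> A),
    (forall i, r i \in S) /\ t = \sum_(i < n) a i * r i * b i.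

Definition is_basis (K : fieldType) (V : lmodType K) (e : seq V) : Prop :=
  (forall a : 'I_(size e) -> K,
     \sum_(i < size e) a i *: e`_i = 0 -> forall i, a i = 0) /\
  (forall v : V, exists a : 'I_(size e) -> K,
     v = \sum_(i < size e) a i *: e`_i).

(* All products of one entry from each row, from the first row to the last.   *)
Definition row_products (A : pzRingType) (rows : seq (seq A)) : seq A :=
  foldr (fun row acc => [seq a * b | a <- row, b <- acc]) [:: 1] rows.

(* The vertex numbered i in 1, 2, 3, 4 is the ordinal i - 1.                  *)
Definition v1 : 'I_4 := @Ordinal 4 0 isT.
Definition v2 : 'I_4 := @Ordinal 4 1 isT.
Definition v3 : 'I_4 := @Ordinal 4 2 isT.
Definition v4 : 'I_4 := @Ordinal 4 3 isT.

(* phi_i in cycle notation: [next s j] is the cyclic successor of j in s, and *)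
(* j itself when j does not occur in s.                                       *)
Definition tetra_cycle (i : 'I_4) : seq 'I_4 :=
  nth [::] [:: [:: v2; v3; v4]; [:: v1; v4; v3]; [:: v1; v2; v4];
               [:: v1; v3; v2]] i.

Definition tetra_act (i j : 'I_4) : 'I_4 := next (tetra_cycle i) j.

Definition tetra_braiding (K : fieldType) (x y : 'I_4) : {tensalg K['I_4]} :=
  - (gen K (tetra_act x y) * gen K x).

Definition tetra_relations (K : fieldType) : seq {tensalg K['I_4]} :=
  let x1 := gen K v1 in let x2 := gen K v2 in
  let x3 := gen K v3 in let x4 := gen K v4 in
  [:: x1 ^+ 2; x2 ^+ 2; x3 ^+ 2; x4 ^+ 2;
      x3 * x1 + x2 * x3 + x1 * x2;
      x4 * x1 + x3 * x4 + x1 * x3;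
      x4 * x2 + x2 * x1 + x1 * x4;
      x4 * x3 + x3 * x2 + x2 * x4;
      x3 * x2 * x1 * x3 * x2 * x1 + x2 * x1 * x3 * x2 * x1 * x3
        + x1 * x3 * x2 * x1 * x3 * x2].

Definition tetra_rows (K : fieldType) : seq (seq {tensalg K['I_4]}) :=
  let x1 := gen K v1 in let x2 := gen K v2 in
  let x3 := gen K v3 in let x4 := gen K v4 in
  [:: [:: 1; x1];
      [:: 1; x2; x2 * x1];
      [:: 1; x3 * x2 * x1];
      [:: 1; x3; x3 * x2];
      [:: 1; x4]].

(* Main.v *)
Require Import Defs.
From HB Require Import structures.
From mathcomp Require Import all_boot all_order all_algebra all_fingroup.
From mathcomp Require Import generic_quotient ring_quotient finmap.
From mathcomp Require Import monalg.
From mathcomp Require Import boolp classical_sets reals.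
From mathcomp Require Import complex zify.

Set Implicit Arguments.
Unset Strict Implicit.
Unset Printing Implicit Defensive.

Import GRing.Theory Num.Theory.

Local Open Scope ring_scope.

(** The relations hold in the Nichols algebra; modulo the relations every
    element is a combination of 72 normal words; these 72 words are linearly
    independent in the Nichols algebra. Together these three facts say that
    the relations generate the whole kernel and that the normal words are a
    basis.

    Write Q for the sum of all quantum symmetrizers, x |> y for the rack
    operation, and e(t) for the constant term of t. The braiding is
    x (x) y |-> - (x |> y) (x) x, with |> self-distributive.

    The kernel of Q. A reduced expression of a permutation draws a braid in
    which two strands cross at most once. When the strand x passes over y,
    x keeps its colour and y becomes x |> y, so the final colour of a strand
    is obtained from its own colour by letting act all the strands that pass
    over it; self-distributivity shows that this depends on the permutation
    only ([braid_expression]). Sorting the permutations by the strand that ends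
    in the last position yields the recursion
      Q(t) = e(t) + sum_x Q(d_x t) x         ([quantum_symmetrizer_skew]),
    where d_x is the skew derivation with d_x(y) = 1 if y = x, and 0 otherwise,
      d_x(s t) = s d_x(t) + d_x(s) g_x(t)    ([skewM]),
    and g_x is the algebra automorphism y |-> - (x |> y). Hence t is in the
    kernel of Q iff all its iterated skew derivatives have constant term 0
    ([quantum_symmetrizer_eq0]). On words these numbers are integers which are
    found by computation. As Q commutes with g_x, the Leibniz rule makes the
    kernel a two-sided ideal, so the projection onto the Nichols algebra is
    multiplicative ([nichols_piM]).

    The relations are in the kernel: all their iterated skew derivatives are
    computed ([tetra_relations_annihilated]).

    The normal words span. Each relation rewrites its largest word (for the
    length first and then the lexicographic order with 1 < 2 < 3 < 4) into
    smaller ones, and the relations imply the two further rules 212 = 121 and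
    323 = 232 ([braid_in_ideal]). The words to which no rule applies are
    exactly the 72 products of entries of the rows ([normal_or_reducible]).

    The normal words are independent. The top degree of the algebra is 9, and
    the word 121321324 of that degree is not in the kernel. The algebra is a
    Frobenius algebra, so a nonzero element can be multiplied on both sides
    into the top degree; concretely, for each normal word m there are normal
    words l and r such that l m r has a nonzero top coefficient, while l m' r
    has top coefficient 0 for every m' after m in the list
    ([normal_words_separated]). *)

(** * Words as a basis of the tensor algebra *)

Section TensorAlgebraTheory.
Variables (K : fieldType) (X : choiceType).
Implicit Types (u v w : seq X) (s t : {tensalg K[X]}).

Lemma word_nil : word K [::] = 1 :> {tensalg K[X]}.
Proof. by rewrite /word; congr << _ >>; apply/esym/fmoneE. Qed.

Lemma word_cat u v : word K (u ++ v) = word K u * word K v.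
Proof.
rewrite /word malgM_def fgmulUU mulr1; congr << _ >>.
exact/esym/(fmmulE (FMonom u) (FMonom v)).
Qed.

Lemma word_cons x w : word K (x :: w) = gen K x * word K w.
Proof. by rewrite -word_cat. Qed.

Lemma mcoeff_word u v : (word K u)@_(FMonom v) = (u == v)%:R.
Proof. by rewrite mcoeffU1 fmP. Qed.

Lemma linext_word (f : seq X -> {tensalg K[X]}) w : linext f (word K w) = f w.
Proof. by rewrite /linext msuppU1 big_seq_fset1 mcoeffUU scale1r. Qed.

Lemma tensalg_ind (P : {tensalg K[X]} -> Prop) :
  P 0 -> (forall a w t, P t -> P (a *: word K w + t)) -> forall t, P t.
Proof.
move=> P0 Pw t; rewrite [t]monalgE; elim/big_rec: _ => // m s _ Ps.
have -> : << t@_m *g m >> = t@_m *: word K (val m).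
  apply/malgP=> k; rewrite mcoeffZ !mcoeffU fmK.
  by case: eqP; rewrite ?mulr1 ?mulr0.
exact: Pw.
Qed.

(** Linear maps are compared on words. With the values in an abstract module,
    the statements proved below reduce to computations with words. *)
Lemma linear_ext (V : lmodType K) (f g : {tensalg K[X]} -> V) :
  linear f -> linear g -> (forall w, f (word K w) = g (word K w)) -> f =1 g.
Proof.
move=> linf ling fg.
have lin0 (h : {tensalg K[X]} -> V) : linear h -> h 0 = 0.
  by move=> /(_ (-1) 0 0); rewrite !scaleN1r !addNr.
elim/tensalg_ind => [|a w t IHt]; first by rewrite (lin0 f) ?(lin0 g).
by rewrite linf ling IHt fg.
Qed.

Lemma bilinear_ext (V : lmodType K) (F G : {tensalg K[X]} -> {tensalg K[X]} -> V) :
  (forall t, linear (F^~ t)) -> (forall s, linear (F s)) ->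
  (forall t, linear (G^~ t)) -> (forall s, linear (G s)) ->
  (forall u v, F (word K u) (word K v) = G (word K u) (word K v)) ->
  forall s t, F s t = G s t.
Proof.
move=> Fl Fr Gl Gr FG s t; move: s.
by apply: (@linear_ext V (F^~ t) (G^~ t)) => // u; move: t; apply: linear_ext.
Qed.

(** Scalars can be moved past the left factor of a product because they are
    central; [tensalg_scalerAr] follows. *)
Lemma malgC_central a s : s * a%:MP = a *: s.
Proof.
move: s; apply: linear_ext => [b s s'|b s s'|w].
- by rewrite mulrDl -scalerAl.
- by rewrite (scalerDr a (b *: s) s') !scalerA (mulrC a b).
have scaleU e : e *: word K w = << e *g FMonom w >>.
  by apply/malgP=> k; rewrite mcoeffZ !mcoeffU; case: eqP; rewrite ?mulr1 ?mulr0.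
by rewrite scaleU /word malgM_def fgmulUU mul1r mulm1.
Qed.

Lemma tensalg_scalerAr a s t : a *: (s * t) = s * (a *: t).
Proof. by rewrite -(mul_malgC a t) mulrA malgC_central -scalerAl. Qed.

End TensorAlgebraTheory.

(** * Reduced expressions of permutations *)

Section ReducedExpressions.
Variable n : nat.
Implicit Types (x : 'S_n) (i : 'I_n.-1) (s : seq 'I_n.-1) (p q : 'I_n).

Definition adj_lo i : 'I_n := Ordinal (ltnW (ltn_adj i)).
Definition adj_hi i : 'I_n := Ordinal (ltn_adj i).

Lemma adj_tpermE i : adj_tperm i = tperm (adj_lo i) (adj_hi i).
Proof. by []. Qed.

Lemma odd_adj_tperm i : odd_perm (adj_tperm i) = true.
Proof. by rewrite odd_tperm -val_eqE /= ltn_eqF. Qed.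

Lemma adj_tperm_order i p q : (p < q)%N ->
  (p = adj_lo i /\ q = adj_hi i) \/ (adj_tperm i p < adj_tperm i q)%N.
Proof.
move=> lt_pq; have val_neq (j k : 'I_n) : j <> k -> nat_of_ord j <> k.
  by move=> neq_jk /val_inj.
rewrite adj_tpermE; case: tpermP => [pE|pE|/val_neq/= p1 /val_neq/= p2];
  case: tpermP => [qE|qE|/val_neq/= q1 /val_neq/= q2];
  do [by left | right]; move: lt_pq; rewrite ?pE ?qE /=; lia.
Qed.

(** The exchange property: some letter of the expression must cross the strands
    that start in p and q, and deleting that letter swaps their ends. *)
Lemma exchange x s p q : expression_of x s -> (p < q)%N -> (x q < x p)%N ->
  exists2 s', expression_of (tperm p q * x)%g s' & size s = (size s').+1.
Proof.
rewrite /expression_of => <- {x}; elim: s p q => [|i s IHs] p q lt_pq.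
  by rewrite big_nil !perm1 => /(ltn_trans lt_pq); rewrite ltnn.
rewrite !big_cons !permM => lt_x.
have [[-> ->]|lt_t] := adj_tperm_order i lt_pq.
  by exists s => //; rewrite -adj_tpermE mulgA tperm2 mul1g.
have [s' xs' szs] := IHs _ _ lt_t lt_x.
exists (i :: s'); last by rewrite /= -szs.
rewrite big_cons xs' !mulgA; congr (_ * _)%g.
by rewrite -tpermJ conjgE tpermV !mulgA tperm2 mul1g.
Qed.

Lemma expression_cons x i s :
  expression_of x (i :: s) -> expression_of (adj_tperm i * x)%g s.
Proof. by rewrite /expression_of big_cons => <-; rewrite mulgA tperm2 mul1g. Qed.

Lemma expression_tperm p q : (p < q)%N -> exists s, expression_of (tperm p q) s.
Proof.
have [m le_qm] := ubnP (q - p)%N; elim: m => // m IHm in p q le_qm *.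
move=> lt_pq; have lt_p : (p < n.-1)%N by have := ltn_ord q; lia.
pose i := Ordinal lt_p; pose r := adj_hi i.
have pE : adj_lo i = p by apply: val_inj.
have [rE|neq_rq] := eqVneq r q.
  by exists [:: i]; rewrite /expression_of big_seq1 adj_tpermE pE -/r rE.
have neq_pq : p != q by rewrite -val_eqE ltn_eqF.
have lt_rq : (r < q)%N by move: neq_rq; rewrite -val_eqE /=; lia.
have [s rs] := IHm r q ltac:(move=> /=; lia) lt_rq.
exists (i :: rcons s i); rewrite /expression_of big_cons big_rcons /=.
rewrite rs -[X in (X * _)%g]tpermV -conjgE tpermJ.
by rewrite -[Ordinal (ltn_adj i)]/r -[Ordinal _]/(adj_lo i) pE tpermR tpermD.
Qed.

Lemma expression_exists x : exists s, expression_of x s.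
Proof.
have [ts -> dts] := prod_tpermP x; elim: ts dts => [|[p q] ts IHts] /=.
  by exists [::]; rewrite /expression_of !big_nil.
case/andP=> neq_pq /IHts[s xs].
have [r pqr] : exists r, expression_of (tperm p q) r.
  case: (ltngtP p q) neq_pq => [/expression_tperm||/val_inj->]//; last by rewrite eqxx.
  by rewrite tpermC => /expression_tperm.
by exists (r ++ s); rewrite /expression_of big_cat pqr xs big_cons.
Qed.

Lemma shortest_expression_exists x : exists s, shortest_expression x s.
Proof.
have [s xs] := expression_exists x.
have ex : exists m, `[< exists2 s, expression_of x s & size s = m >].
  by exists (size s); apply/asboolP; exists s.
case: (ex_minnP ex) => m /asboolP[r xr <-] min_r.
by exists r; split=> // t xt; apply: min_r; apply/asboolP; exists t.
Qed.

(** In a shortest expression every letter creates a new inversion, since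
    otherwise the exchange property would provide a shorter expression. *)
Lemma shortest_cons x i s : shortest_expression x (i :: s) ->
  let x' := (adj_tperm i * x)%g in
  shortest_expression x' s /\ (x' (adj_lo i) < x' (adj_hi i))%N.
Proof.
case=> xs min_s x'; have xs' := expression_cons xs; split; first split=> //.
  move=> r xr; rewrite -ltnS; apply: (min_s (i :: r)).
  by rewrite /expression_of big_cons xr mulgA tperm2 mul1g.
rewrite ltnNge leq_eqVlt negb_or; apply/andP; split.
  by rewrite val_eqE (inj_eq perm_inj) -val_eqE /= gtn_eqF.
apply/negP => gt_x.
have [r xr szs] := exchange xs' (ltnSn _ : (adj_lo i < adj_hi i)%N) gt_x.
suff /min_s : expression_of x r by rewrite /= szs ltnNge leqnSn.
by move: xr; rewrite -adj_tpermE mulgA tperm2 mul1g.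
Qed.

End ReducedExpressions.

(** * Colours of the strands of a reduced braid *)

Section StrandColours.
Variables (X : Type) (op : X -> X -> X).
Hypothesis opD : forall a b z, op a (op b z) = op (op a b) (op a z).

Definition act_seq (s : seq X) (z : X) : X := foldr op z s.

Lemma act_seqD s a z : act_seq s (op a z) = op (act_seq s a) (act_seq s z).
Proof. by elim: s => //= b s ->; rewrite opD. Qed.

Lemma act_seq_map a s z :
  act_seq [seq op a b | b <- s] (op a z) = op a (act_seq s z).
Proof. by elim: s => //= b s ->; rewrite -opD. Qed.

Lemma act_seq_cat s r z : act_seq (s ++ r) z = act_seq s (act_seq r z).
Proof. exact: foldr_cat. Qed.

(** The product of permutations being read from left to right, the strand that
    ends in p starts in x p, and the strand that starts in k ends in x^-1 k. The
    strands below start to the left of that strand and end to its right. *)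
Definition overstrands n (x : 'S_n) (p : 'I_n) : seq 'I_n :=
  [seq k : 'I_n <- enum 'I_n | (k < x p)%N && (p < (x^-1)%g k)%N].

(** The strands passing over act with their initial colours, the leftmost one
    acting last. They may have changed colour before the crossing, but by
    self-distributivity this is already accounted for by the action of the
    strands that have passed over them: these pass over the given strand too. *)
Definition colour n (x : 'S_n) (f : 'I_n -> X) (p : 'I_n) : X :=
  act_seq [seq f k | k <- overstrands x p] (f (x p)).

Lemma val_enum_ord_lt n m : (m <= n)%N ->
  [seq val k | k : 'I_n <- enum 'I_n & (k < m)%N] = iota 0 m.
Proof.
move=> le_mn; have -> : [seq val k | k : 'I_n <- enum 'I_n & (k < m)%N]
    = [seq k <- iota 0 n | (k < m)%N] by rewrite -val_enum_ord filter_map.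
rewrite -(subnKC le_mn) iotaD filter_cat.
rewrite (@eq_in_filter _ _ predT); last by move=> k; rewrite mem_iota.
rewrite filter_predT (@eq_in_filter _ _ pred0) ?filter_pred0 ?cats0 // => k.
by rewrite mem_iota => /andP[le_mk _]; rewrite ltnNge le_mk.
Qed.

Lemma val_enum_ord_ge n m : (m <= n)%N ->
  [seq val k | k : 'I_n <- enum 'I_n & (m <= k)%N] = iota m (n - m).
Proof.
move=> le_mn; have -> : [seq val k | k : 'I_n <- enum 'I_n & (m <= k)%N]
    = [seq k <- iota 0 n | (m <= k)%N] by rewrite -val_enum_ord filter_map.
rewrite -{1}(subnKC le_mn) iotaD filter_cat.
rewrite (@eq_in_filter _ _ pred0) => [|k]; last first.
  by rewrite mem_iota => /andP[_ lt_km]; rewrite leqNgt lt_km.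
rewrite filter_pred0 (@eq_in_filter _ _ predT) ?filter_predT // => k.
by rewrite mem_iota => /andP[].
Qed.

Lemma enum_ord_cut n m : (m <= n)%N ->
  enum 'I_n = [seq k : 'I_n <- enum 'I_n | (k < m)%N] ++
              [seq k : 'I_n <- enum 'I_n | (m <= k)%N].
Proof.
move=> le_mn; apply: (inj_map val_inj); rewrite map_cat.
by rewrite val_enum_ord val_enum_ord_lt // val_enum_ord_ge // -iotaD subnKC.
Qed.

Lemma enum_ord_split n (m : 'I_n) :
  enum 'I_n = [seq k : 'I_n <- enum 'I_n | (k < m)%N]
    ++ m :: [seq k : 'I_n <- enum 'I_n | (m < k)%N].
Proof.
apply: (inj_map val_inj); rewrite map_cat /= val_enum_ord.
rewrite val_enum_ord_lt 1?ltnW // (@val_enum_ord_ge n m.+1) //.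
by rewrite -[_ :: _]/(iota (0 + m) _.+1) -iotaD -subSn // subSS subnKC 1?ltnW.
Qed.

(** [lift i] skips i, so it shifts by one the indices from i on. *)
Lemma enum_ord_lift n (i : 'I_n.+1) :
  enum 'I_n.+1 = [seq lift i k | k : 'I_n <- enum 'I_n & (k < i)%N] ++
            i :: [seq lift i k | k : 'I_n <- enum 'I_n & (i <= k)%N].
Proof.
have le_in : (i <= n)%N by rewrite -ltnS.
have val_lift (s : seq 'I_n) :
    [seq val k | k <- [seq lift i k | k <- s]] =
    [seq bump i k | k <- [seq val k | k <- s]].
  by rewrite -!map_comp.
rewrite {1}(enum_ord_split i); congr (_ ++ _ :: _); apply: (inj_map val_inj).
  rewrite val_lift !val_enum_ord_lt // 1?leqW // -[LHS]map_id.
  by apply/eq_in_map => k; rewrite mem_iota add0n /bump ltnNge => /andP[_ /negbTE->].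
rewrite val_lift (@val_enum_ord_ge n.+1 i.+1) // val_enum_ord_ge // subSS.
rewrite -[i.+1]addn1 addnC iotaDl; apply/eq_in_map => k.
by rewrite mem_iota /bump => /andP[->].
Qed.

(** A crossing of neighbours that are not inverted yet: the new colours are
    those prescribed by the braiding. *)
Section AdjacentStep.
Variables (n : nat) (x : 'S_n) (f : 'I_n -> X) (i : 'I_n.-1).
Hypothesis lt_x : (x (adj_lo i) < x (adj_hi i))%N.

Let tx := (adj_tperm i * x)%g.

Let tx_inv k : tx^-1%g k = adj_tperm i (x^-1%g k).
Proof. by rewrite invMg permM tpermV. Qed.

Let adj_cases (q : 'I_n) :
  [\/ q = adj_lo i /\ adj_tperm i q = adj_hi i,
      q = adj_hi i /\ adj_tperm i q = adj_lo i
    | [/\ (q : nat) <> i, (q : nat) <> i.+1 & adj_tperm i q = q]].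
Proof.
rewrite adj_tpermE; case: tpermP => [->|->|lo hi].
- by constructor 1.
- by constructor 2.
by constructor 3; split=> // qE; [apply: lo|apply: hi]; apply: val_inj.
Qed.

Lemma colour_adj_other p : p != adj_lo i -> p != adj_hi i ->
  colour tx f p = colour x f p.
Proof.
move=> p_lo p_hi; rewrite /colour /overstrands permM.
have -> : adj_tperm i p = p by rewrite adj_tpermE tpermD // eq_sym.
congr act_seq; congr map; apply: eq_filter => k; rewrite tx_inv; congr (_ && _).
move: p_lo p_hi; rewrite -!val_eqE /=.
by have [[-> ->]|[-> ->]|[_ _ ->]] //= := adj_cases (x^-1%g k); lia.
Qed.

Lemma colour_adj_hi : colour tx f (adj_hi i) = colour x f (adj_lo i).
Proof.
rewrite /colour /overstrands permM adj_tpermE tpermR.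
congr act_seq; congr map; apply: eq_filter => k; rewrite tx_inv.
have [[kE ->]|[kE ->]|[lo hi ->]] := adj_cases (x^-1%g k).
- by rewrite kE -[k](permKV x) kE !ltnn.
- by rewrite kE -[k](permKV x) kE /= ltnNge ltnW.
congr (_ && _) => /=; lia.
Qed.

(** Let k = x lo be the start of the strand passing over. The strands acting on
    the new colour of the lower strand are those acting on k, then k itself,
    then those that start to the right of k; self-distributivity takes the
    first group out of this composite. *)
Lemma colour_adj_lo :
  colour tx f (adj_lo i) = op (colour x f (adj_lo i)) (colour x f (adj_hi i)).
Proof.
rewrite /colour /overstrands permM adj_tpermE tpermL.
have lt_lo_hi := lt_x; set lo := adj_lo i in lt_lo_hi *.
set hi := adj_hi i in lt_lo_hi *.
rewrite (enum_ord_split (x lo)) !filter_cat /= tx_inv permK adj_tpermE tpermL.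
rewrite lt_lo_hi [(lo < hi)%N]ltnSn !ltnn [(hi < lo)%N]ltnNge leqnSn andbF /=.
set s1 := filter _ (enum _); set s3 := filter _ (enum _).
have s1P (k : 'I_n) : k \in s1 -> (k < x lo)%N by rewrite mem_filter => /andP[].
have s3P (k : 'I_n) : k \in s3 -> (x lo < k)%N by rewrite mem_filter => /andP[].
have later (k : 'I_n) : (k : nat) <> x lo -> (k : nat) <> x hi ->
    (i < (tx^-1)%g k)%N = (i < (x^-1)%g k)%N /\
    (i.+1 < (x^-1)%g k)%N = (i < (x^-1)%g k)%N.
  rewrite tx_inv; have [[kE _]|[kE _]|[q_lo q_hi ->]] := adj_cases ((x^-1)%g k).
  - by rewrite -{1}[k](permKV x) kE.
  - by rewrite -{2}[k](permKV x) kE.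
  by move=> _ _; split=> //; lia.
set new := fun k : 'I_n => (k < x hi)%N && (i < (tx^-1)%g k)%N.
set old_lo := fun k : 'I_n => (k < x lo)%N && (i < (x^-1)%g k)%N.
set old_hi := fun k : 'I_n => (k < x hi)%N && (i.+1 < (x^-1)%g k)%N.
have -> : filter new s1 = filter old_lo s1.
  apply: eq_in_filter => k /s1P k1; have [||+ _] := later k;
    rewrite /new /old_lo; lia.
have -> : filter old_hi s1 = filter old_lo s1.
  apply: eq_in_filter => k /s1P k1; have [||_ +] := later k;
    rewrite /old_hi /old_lo; lia.
have -> : filter old_hi s3 = filter new s3.
  apply: eq_in_filter => k /s3P k3; rewrite /old_hi /new.
  by case: ltngtP => //= k_hi; have [||-> ->] := later k; lia.
have -> : filter old_lo s3 = [::].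
  rewrite -(filter_pred0 s3); apply: eq_in_filter => k /s3P k3.
  by rewrite /old_lo ltnNge ltnW.
by rewrite cats0 !map_cat /= !act_seq_cat -act_seqD.
Qed.

End AdjacentStep.

(** When the strand starting in i ends last, it can first be pulled to the far
    right, over all the strands that start to its right; the other strands then
    follow a permutation of their own. *)
Section LastStrand.
Variables (n : nat) (f : 'I_n.+1 -> X) (i : 'I_n.+1) (y : 'S_n).

Definition pull_out (k : 'I_n) : X :=
  if (k < i)%N then f (lift i k) else op (f i) (f (lift i k)).

Let x := lift_perm ord_max i y.

Lemma colour_lift_last : colour x f ord_max = f i.
Proof.
rewrite /colour lift_perm_id /overstrands.
rewrite (@eq_filter _ _ pred0) ?filter_pred0 // => k /=.
by rewrite [(n < _)%N]ltnNge leq_ord andbF.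
Qed.

Lemma colour_lift p : colour x f (lift ord_max p) = colour y pull_out p.
Proof.
have le_in : (i <= n)%N by rewrite -ltnS.
rewrite /colour /overstrands lift_perm_lift (enum_ord_cut le_in) (enum_ord_lift i).
set s1 := filter _ (enum _); set s3 := filter _ (enum _).
have s1P (k : 'I_n) : k \in s1 -> (k < i)%N by rewrite mem_filter => /andP[].
have s3P (k : 'I_n) : k \in s3 -> (i <= k)%N by rewrite mem_filter => /andP[].
rewrite !filter_cat /= !filter_map.
rewrite lift_permV lift_perm_id /=.
have bump_n (q : 'I_n) : bump n q = q by rewrite /bump leqNgt ltn_ord.
have lift_crossing (k : 'I_n) :
    (p < lift_perm i ord_max y^-1 (lift i k))%N = (p < (y^-1)%g k)%N.
  by rewrite lift_perm_lift /= bump_n.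
rewrite bump_n ltn_ord andbT.
set crossing := fun k : 'I_n => (k < y p)%N && (p < (y^-1)%g k)%N.
rewrite (@eq_in_filter _ _ crossing s1) => [|k /s1P k1]; last first.
  rewrite /= lift_crossing /crossing; congr (_ && _); rewrite /bump; lia.
rewrite (@eq_in_filter _ (preim _ _) crossing s3) => [|k /s3P k3]; last first.
  rewrite /= lift_crossing /crossing; congr (_ && _); rewrite /bump; lia.
have map1 : [seq pull_out k | k <- filter crossing s1]
    = [seq f (lift i k) | k <- filter crossing s1].
  by apply/eq_in_map => k; rewrite mem_filter => /andP[_ /s1P];
    rewrite /pull_out => ->.
have map3 : [seq pull_out k | k <- filter crossing s3]
    = [seq op (f i) z | z <- [seq f (lift i k) | k <- filter crossing s3]].
  rewrite -map_comp; apply/eq_in_map => k; rewrite mem_filter => /andP[_ /s3P k3].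
  by rewrite /pull_out /= ltnNge k3.
rewrite !map_cat map1 map3; have [lt_yi|le_iy] := ltnP (y p) i.
  (* The strand starts to the left of i, and the strand i does not meet it. *)
  have -> : filter crossing s3 = [::].
    rewrite -(filter_pred0 s3); apply: eq_in_filter => k /s3P k3.
    by rewrite /crossing /=; lia.
  rewrite /pull_out lt_yi; have -> : (i < bump i (y p))%N = false.
    by rewrite /bump; lia.
  by rewrite /= !cats0 -map_comp.
(* The strand i acts between the strands to its left and those to its right. *)
have -> : (i < bump i (y p))%N by rewrite /bump; lia.
by rewrite /pull_out ltnNge le_iy /= !act_seq_cat act_seq_map /= -!map_comp.
Qed.

End LastStrand.

End StrandColours.

(** * The quantum symmetrizer of a rack braiding *)

Section RackBraiding.
Variables (K : fieldType) (X : choiceType) (op : X -> X -> X).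
Hypothesis opD : forall a b z, op a (op b z) = op (op a b) (op a z).

Definition rack_braiding (a b : X) : {tensalg K[X]} :=
  - (gen K (op a b) * gen K a).

Local Notation c := rack_braiding.

Definition colours n (x : 'S_n) (f : 'I_n -> X) : seq X :=
  [seq colour op x f p | p <- enum 'I_n].

Lemma size_colours n (x : 'S_n) f : size (colours x f) = n.
Proof. by rewrite size_map size_enum_ord. Qed.

Lemma nth_colours n (x : 'S_n) f z (p : 'I_n) :
  nth z (colours x f) p = colour op x f p.
Proof. by rewrite (nth_map p) ?size_enum_ord // nth_ord_enum. Qed.

Lemma colours1 n (f : 'I_n -> X) : colours 1 f = [seq f p | p <- enum 'I_n].
Proof.
have [x xE] : exists x : 'S_n, x = 1%g by exists 1%g.
have xK q : x q = q by rewrite xE perm1.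
rewrite -xE; apply: eq_map => p; rewrite /colour /overstrands xK.
rewrite (@eq_filter _ _ pred0) ?filter_pred0 // => k /=.
by rewrite -{1}[k](permKV x) xK; case: ltngtP.
Qed.

Lemma sigma_colours n (x : 'S_n) f (i : 'I_n.-1) :
  (x (adj_lo i) < x (adj_hi i))%N ->
  sigma c i (word K (colours x f)) =
  - word K (colours (adj_tperm i * x)%g f).
Proof.
move=> lt_x; rewrite /sigma linext_word /sigma_word.
pose z := f (adj_lo i); set tx := (adj_tperm i * x)%g.
have lt_i2 : (i.+1 < n)%N := ltn_adj i.
rewrite (drop_nth z) ?size_colours ?(ltnW lt_i2) //.
rewrite (drop_nth z) ?size_colours //.
rewrite (nth_colours x f z (adj_lo i)) (nth_colours x f z (adj_hi i)).
rewrite mulrN mulNr -!word_cat; congr (- word K _).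
have size_i : size (take i (colours x f)) = i.
  by rewrite size_takel // size_colours ltnW // ltnW.
apply: (@eq_from_nth _ z).
  rewrite !size_cat size_i size_drop !size_colours /=; lia.
move=> k; rewrite !size_cat size_i size_drop size_colours /= => lt_k.
have [p kE] : exists p : 'I_n, k = p.
  by have k_n : (k < n)%N by [lia]; exists (Ordinal k_n).
rewrite {k lt_k}kE (nth_colours tx) -catA nth_cat size_i.
have [lt_pi|lt_ip|eq_pi] := ltngtP p i.
- rewrite nth_take // nth_colours colour_adj_other // -val_eqE /=; lia.
- have [p_hi|neq_p] := eqVneq (p : nat) i.+1.
    rewrite p_hi subSnn /= -(colour_adj_hi op f lt_x); congr colour.
    exact: val_inj.
  have -> : (p - i = (p - i.+2).+2)%N by lia.
  rewrite /= nth_drop subnKC; last by lia.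
  rewrite nth_colours colour_adj_other // -val_eqE /=; lia.
rewrite eq_pi subnn /= -(colour_adj_lo opD f lt_x); congr colour.
exact: val_inj.
Qed.

Lemma sigmaZ i a t : sigma c i (a *: t) = a *: sigma c i t.
Proof. exact: linearZ. Qed.

(** The right-hand side does not mention the expression: for these braidings the
    choice of a reduced expression in the braid lift is indeed immaterial. *)
Lemma braid_expression n (x : 'S_n) f s : shortest_expression x s ->
  foldr (fun (i : 'I_n.-1) g => sigma c i \o g) id s
    (word K [seq f p | p <- enum 'I_n]) =
  (-1) ^+ (x : bool) *: word K (colours x f).
Proof.
elim: s x => [|i s IHs] x xs.
  by case: xs => <- _; rewrite big_nil odd_perm1 scale1r colours1.
have [xs' lt_x] := shortest_cons xs; rewrite /= (IHs _ xs').
rewrite sigmaZ (sigma_colours f lt_x).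
rewrite mulgA tperm2 mul1g scalerN -scaleNr odd_permM odd_adj_tperm.
by case: (odd_perm x); rewrite ?opprK.
Qed.

Lemma quantum_symmetrizer_colours n (f : 'I_n -> X) :
  quantum_symmetrizer c (word K [seq f p | p <- enum 'I_n]) =
  \sum_(x : 'S_n) (-1) ^+ (x : bool) *: word K (colours x f).
Proof.
rewrite /quantum_symmetrizer linext_word.
transitivity (\sum_(x : 'S_n) braid_lift c x (word K [seq f p | p <- enum 'I_n])).
  have szE : size [seq f p | p <- enum 'I_n] = n.
    by rewrite size_map size_enum_ord.
  by move: (word K _) => t; move: (size _) szE => m ->.
apply: eq_bigr => x _; rewrite /braid_lift.
have [s xs] := shortest_expression_exists x.
by apply: braid_expression; apply: xgetPex; exists s.
Qed.

(** The sign (-1)^(n - i) counts the crossings needed to bring the strand i to the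
    last position. *)
Lemma quantum_symmetrizer_last n (f : 'I_n.+1 -> X) :
  quantum_symmetrizer c (word K [seq f p | p <- enum 'I_n.+1]) =
  \sum_(i < n.+1) (-1) ^+ (n - i) *:
     (quantum_symmetrizer c (word K [seq pull_out op f i k | k <- enum 'I_n]) *
      gen K (f i)).
Proof.
rewrite quantum_symmetrizer_colours.
pose h (iy : 'I_n.+1 * 'S_n) := lift_perm ord_max iy.1 iy.2.
have h_inj : injective h.
  move=> [i y] [j z] /= hE; have ij : i = j.
    by have := congr1 (fun x : 'S_n.+1 => x ord_max) hE; rewrite /h !lift_perm_id.
  rewrite ij in hE *; congr pair; apply/permP => k; apply: (@lift_inj _ j).
  by rewrite -!(lift_perm_lift ord_max) -[lift_perm _ _ y]/(h (j, y)) hE.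
have h_bij : bijective h.
  apply: inj_card_bij h_inj _.
  by rewrite card_prod card_ord !card_Sn factS.
rewrite (reindex h) /=; last exact: onW_bij.
rewrite -(pair_bigA _ (fun i y =>
  (-1) ^+ (h (i, y) : bool) *: word K (colours (h (i, y)) f))) /=.
apply: eq_bigr => i _; rewrite quantum_symmetrizer_colours mulr_suml scaler_sumr.
apply: eq_bigr => y _.
rewrite /h /= odd_lift_perm /= -scalerAl scalerA.
have -> : colours (lift_perm ord_max i y) f = colours y (pull_out op f i) ++ [:: f i].
  rewrite /colours enum_ordSr map_rcons colour_lift_last cats1 -map_comp.
  congr rcons; apply: eq_map => p; rewrite -colour_lift //=; congr colour.
  by apply: val_inj; rewrite /= /bump leqNgt ltn_ord.
have sgnE : (-1) ^+ (odd n (+) odd i (+) y) =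
    (-1) ^+ (n - i) * (-1) ^+ (y : bool) :> K.
  by rewrite -oddB ?leq_ord // signr_addb signr_odd.
by rewrite word_cat sgnE.
Qed.

End RackBraiding.

(** * Skew derivations and the kernel of the quantum symmetrizer *)

Section SkewDerivations.
Variables (K : fieldType) (X : finType) (op : X -> X -> X).
Hypothesis opD : forall a b z, op a (op b z) = op (op a b) (op a z).

Local Notation c := (rack_braiding K op).
Implicit Types (x y z : X) (u v w ys : seq X) (s t : {tensalg K[X]}).

Definition combination (p : seq (int * seq X)) : {tensalg K[X]} :=
  \sum_(q <- p) q.1%:~R *: word K q.2.

(** An occurrence of x is moved to the end of the word, where it is erased; on
    its way it acts on the letters to its right, with one sign for each. The
    result is kept as a formal integer combination of words, on which one can
    compute. *)
Fixpoint skew_word x w : seq (int * seq X) :=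
  if w is y :: w' then
    (if y == x then [:: ((-1) ^+ size w', [seq op x z | z <- w'])] else [::])
      ++ [seq (q.1, y :: q.2) | q <- skew_word x w']
  else [::].

Definition skew x : {tensalg K[X]} -> {tensalg K[X]} :=
  linext (fun w => combination (skew_word x w)).
HB.instance Definition _ x := GRing.Linear.on (skew x).

(** The braiding with x, up to its last factor: the algebra automorphism that
    sends each letter y to - op x y. *)
Definition twist x : {tensalg K[X]} -> {tensalg K[X]} :=
  linext (fun w => (-1) ^+ size w *: word K [seq op x z | z <- w]).
HB.instance Definition _ x := GRing.Linear.on (twist x).

Lemma skewP x a s t : skew x (a *: s + t) = a *: skew x s + skew x t.
Proof. exact: linext_is_linear. Qed.

Lemma twistP x a s t : twist x (a *: s + t) = a *: twist x s + twist x t.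
Proof. exact: linext_is_linear. Qed.

Lemma quantum_symmetrizerP a s t : quantum_symmetrizer c (a *: s + t) =
  a *: quantum_symmetrizer c s + quantum_symmetrizer c t.
Proof. exact: linext_is_linear. Qed.

Lemma twistZ x a t : twist x (a *: t) = a *: twist x t.
Proof. exact: linearZ. Qed.

Lemma quantum_symmetrizerZ a t :
  quantum_symmetrizer c (a *: t) = a *: quantum_symmetrizer c t.
Proof. exact: linearZ. Qed.

Lemma twist_word x w :
  twist x (word K w) = (-1) ^+ size w *: word K [seq op x z | z <- w].
Proof. exact: linext_word. Qed.

Lemma skew_word_nil x : skew x (word K [::]) = 0.
Proof. by rewrite /skew linext_word /combination big_nil. Qed.

Lemma skew_word_cons x y w : skew x (word K (y :: w)) =
  (y == x)%:R *: twist x (word K w) + gen K y * skew x (word K w).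
Proof.
rewrite /skew !linext_word /combination /= big_cat big_map /=; congr (_ + _).
  rewrite twist_word; case: eqP => _; last by rewrite big_nil scale0r.
  by rewrite big_seq1 scale1r /= rmorphXn /= rmorphN1.
rewrite mulr_sumr; apply: eq_bigr => q _.
by rewrite word_cons tensalg_scalerAr.
Qed.

Lemma addr_scaleACA (V : lmodType K) a (p q r t : V) :
  a *: p + q + (a *: r + t) = a *: (p + r) + (q + t).
Proof. by rewrite addrACA scalerDr. Qed.

Lemma leibniz_linearl (A : lalgType K) (a : K) (s s' d d' k g : A) :
  (a *: s + s') * k + (a *: d + d') * g =
  a *: (s * k + d * g) + (s' * k + d' * g).
Proof. by rewrite !mulrDl -!scalerAl addr_scaleACA. Qed.

Lemma leibniz_step (A : lalgType K) (d : K) (g w sv su tv tu : A) :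
  d *: (tu * tv) + g * (w * sv + su * tv) = g * w * sv + (d *: tu + g * su) * tv.
Proof. by rewrite mulrDr mulrDl !mulrA addrCA -scalerAl. Qed.

Lemma twistM x s t : twist x (s * t) = twist x s * twist x t.
Proof.
move: s t; apply: bilinear_ext => [t a s s'|s a t t'|t a s s'|s a t t'|u v].
- by rewrite mulrDl -scalerAl linearP.
- by rewrite mulrDr -tensalg_scalerAr linearP.
- by rewrite linearP mulrDl -scalerAl.
- by rewrite linearP mulrDr -tensalg_scalerAr.
rewrite -word_cat !twist_word map_cat word_cat size_cat exprD.
by rewrite -scalerAl -tensalg_scalerAr scalerA.
Qed.

(** The letter x moved out of the left factor has to cross the right factor. *)
Lemma skewM x s t : skew x (s * t) = s * skew x t + skew x s * twist x t.
Proof.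
move: s t; apply: bilinear_ext => [t a s s'|s a t t'|t a s s'|s a t t'|u v].
- by rewrite mulrDl -scalerAl linearP.
- by rewrite mulrDr -tensalg_scalerAr linearP.
- by rewrite skewP; exact: leibniz_linearl.
- rewrite skewP twistP (mulrDr s) (mulrDr (skew x s)).
  by rewrite -2!tensalg_scalerAr addr_scaleACA.
rewrite -word_cat; elim: u => [|y u IHu].
  by rewrite word_nil mul1r -word_nil skew_word_nil mul0r addr0.
rewrite cat_cons (skew_word_cons x y (u ++ v)) (skew_word_cons x y u).
rewrite (word_cons K y u) IHu word_cat twistM.
exact: leibniz_step.
Qed.

(** The constant term of an iterated skew derivative. It is the coefficient of
    the quantum symmetrizer at the reversed word, the letters being split off
    from the right, see [mcoeff_quantum_symmetrizer]. *)
Fixpoint wcoef ys t : K :=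
  if ys is y :: ys' then wcoef ys' (skew y t) else t@_(FMonom [::]).

Lemma wcoef_is_linear ys : linear (wcoef ys : {tensalg K[X]} -> K^o).
Proof.
elim: ys => [|y ys IHys] a s t /=; first by rewrite mcoeffD mcoeffZ.
by rewrite linearP IHys.
Qed.
HB.instance Definition _ ys := GRing.isLinear.Build K {tensalg K[X]} K^o _
  (wcoef ys) (wcoef_is_linear ys).

Lemma wcoefP ys a s t : wcoef ys (a *: s + t) = a * wcoef ys s + wcoef ys t.
Proof. exact: wcoef_is_linear. Qed.

Lemma wcoefZ ys a t : wcoef ys (a *: t) = a * wcoef ys t.
Proof. exact: linearZ. Qed.

Lemma wcoef_sum ys N (F : 'I_N -> {tensalg K[X]}) :
  wcoef ys (\sum_i F i) = \sum_i wcoef ys (F i).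
Proof. exact: linear_sum. Qed.

Lemma wcoefD ys s t : wcoef ys (s + t) = wcoef ys s + wcoef ys t.
Proof. by rewrite -[s]scale1r wcoefP mul1r scale1r. Qed.

(** The integer version of [wcoef] on words, by recursion on lists only, so that
    it can be evaluated. *)
Fixpoint icoef ys w : int :=
  if ys is y :: ys' then
    foldr (fun q n => q.1 * icoef ys' q.2 + n) 0 (skew_word y w)
  else (w == [::])%:R.

Lemma wcoef_word ys w : wcoef ys (word K w) = (icoef ys w)%:~R.
Proof.
elim: ys w => [|y ys IHys] w /=; first by rewrite mcoeff_word; case: eqP.
rewrite /skew linext_word /combination.
elim: (skew_word y w) => [|q p IHp] /=; first by rewrite big_nil raddf0.
by rewrite big_cons wcoefP IHys IHp intrD intrM.
Qed.

(** All skew derivatives of a word together list its positions: this turns the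
    recursion over positions into one over letters. *)
Lemma skew_positions (V : lmodType K) (G : X -> seq X -> V) z0 w :
  \sum_x \sum_(q <- skew_word x w) q.1%:~R *: G x q.2 =
  \sum_(i < size w) (-1) ^+ (size w - i.+1) *:
     G (nth z0 w i) (take i w ++ [seq op (nth z0 w i) z | z <- drop i.+1 w]).
Proof.
elim: w G => [|y w IHw] G /=.
  by rewrite big_ord0 big1 // => x _; rewrite big_nil.
rewrite big_ord_recl /= subn1 /= drop0.
under eq_bigr => x _ do rewrite big_cat big_map /=.
rewrite big_split /= (IHw (fun x u => G x (y :: u))); congr (_ + _).
rewrite (bigD1 y) //= eqxx big_seq1 /= rmorphXn rmorphN1 big1 ?addr0 // => x.
by rewrite eq_sym => /negbTE->; rewrite big_nil.
Qed.

Lemma quantum_symmetrizer_nil : quantum_symmetrizer c (word K [::]) = 1.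
Proof.
have f : 'I_0 -> X by case.
have := quantum_symmetrizer_colours K opD f.
rewrite (size0nil (size_enum_ord 0)) /= => ->.
rewrite (big_pred1 1%g) => [|x].
  by rewrite odd_perm1 scale1r /colours (size0nil (size_enum_ord 0)) word_nil.
by apply/esym/eqP/permP => -[].
Qed.

Lemma pull_out_word n (f : 'I_n.+1 -> X) (i : 'I_n.+1) z0 :
  let w := [seq f k | k <- enum 'I_n.+1] in
  [seq pull_out op f i k | k <- enum 'I_n] =
  take i w ++ [seq op (nth z0 w i) z | z <- drop i.+1 w].
Proof.
have le_in : (i <= n)%N by rewrite -ltnS.
rewrite /= [in LHS](enum_ord_cut le_in) (enum_ord_lift i) !map_cat /=.
set s1 := filter _ _; set s3 := filter _ _.
have size_s1 : size s1 = i by rewrite -(size_map val) val_enum_ord_lt ?size_iota.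
have size_map1 : size [seq f k | k <- [seq lift i k | k <- s1]] = i.
  by rewrite !size_map.
rewrite nth_cat drop_cat size_map1 ltnn subnn ltnNge leqnSn /= subSnn /= drop0.
rewrite take_size_cat // -!map_comp; congr (_ ++ _); apply/eq_in_map => k.
  by rewrite mem_filter /pull_out => /andP[->].
by rewrite mem_filter /pull_out ltnNge => /andP[->].
Qed.

Lemma addr_scale_sum (V : lmodType K) (a d e : K) (o S S1 S2 : V) :
  S = a *: S1 + S2 -> (a * d + e) *: o + S = a *: (d *: o + S1) + (e *: o + S2).
Proof. by move=> ->; rewrite scalerDl -scalerA addr_scaleACA. Qed.

Lemma skew_sum_linear :
  linear (fun t => \sum_x quantum_symmetrizer c (skew x t) * gen K x).
Proof.
move=> a s t; rewrite scaler_sumr -big_split; apply: eq_bigr => x _ /=.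
rewrite skewP quantum_symmetrizerP.
by rewrite mulrDl -scalerAl.
Qed.

(** The recursion that governs everything below: the quantum symmetrizer is
    computed by splitting off the last letter in all possible ways. *)
Lemma quantum_symmetrizer_skew t : quantum_symmetrizer c t =
  t@_(FMonom [::]) *: 1 + \sum_x quantum_symmetrizer c (skew x t) * gen K x.
Proof.
move: t; apply: linear_ext => [|a s t|w].
- exact: linext_is_linear.
- rewrite mcoeffD mcoeffZ; apply: addr_scale_sum; exact: skew_sum_linear.
case: w => [|z0 w].
  rewrite quantum_symmetrizer_nil mcoeff_word eqxx scale1r big1 ?addr0 // => x _.
  by rewrite skew_word_nil raddf0 mul0r.
rewrite mcoeff_word scale0r add0r.
pose n := size w; pose f (i : 'I_n.+1) := nth z0 (z0 :: w) i.
have wE : z0 :: w = [seq f k | k <- enum 'I_n.+1].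
  by rewrite -[LHS](mkseq_nth z0) /mkseq -val_enum_ord -map_comp.
under eq_bigr => x _.
  rewrite /skew linext_word /combination linear_sum mulr_suml.
  under eq_bigr => q _ do rewrite linearZ -scalerAl.
  over.
rewrite (skew_positions (fun x u => quantum_symmetrizer c (word K u) * gen K x) z0).
rewrite wE quantum_symmetrizer_last // size_map size_enum_ord.
apply: eq_bigr => i _; rewrite subSS (pull_out_word f i z0).
have -> : nth z0 [seq f k | k <- enum 'I_n.+1] i = f i.
  by rewrite (nth_map i) ?size_enum_ord // nth_ord_enum.
by [].
Qed.

Lemma mcoeff_one v : (1 : {tensalg K[X]})@_(FMonom v) = (v == [::])%:R.
Proof. by rewrite -word_nil mcoeff_word eq_sym. Qed.

Lemma mcoeff_mul_gen_nil s x : (s * gen K x)@_(FMonom [::]) = 0.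
Proof.
move: s; apply: (@linear_ext _ _ K^o
  (fun s => (s * gen K x)@_(FMonom [::])) (fun _ => 0)).
- by move=> a s t; rewrite mulrDl -scalerAl mcoeffD mcoeffZ.
- by move=> a s t; rewrite scaler0 addr0.
by move=> w; rewrite -word_cat mcoeff_word; case: w.
Qed.

Lemma mcoeff_mul_gen s x v y :
  (s * gen K x)@_(FMonom (rcons v y)) = (y == x)%:R * s@_(FMonom v).
Proof.
move: s; apply: (@linear_ext _ _ K^o (fun s => (s * gen K x)@_(FMonom (rcons v y)))
   (fun s => (y == x)%:R * s@_(FMonom v))).
- by move=> a s t; rewrite mulrDl -scalerAl mcoeffD mcoeffZ.
- by move=> a s t; rewrite mcoeffD mcoeffZ mulrDr mulrCA.
move=> w; rewrite -word_cat 2!mcoeff_word cats1 eqseq_rcons andbC eq_sym.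
by case: eqP; case: eqP; rewrite ?mulr1 ?mulr0 ?mul0r.
Qed.

Lemma sum_delta y (h : X -> K) : \sum_x (y == x)%:R * h x = h y.
Proof.
rewrite (bigD1 y) //= eqxx mul1r big1 ?addr0 // => x.
by rewrite eq_sym => /negbTE->; rewrite mul0r.
Qed.

Lemma mcoeff_quantum_symmetrizer ys t :
  (quantum_symmetrizer c t)@_(FMonom (rev ys)) = wcoef ys t.
Proof.
elim: ys t => [|y ys IHys] t; rewrite quantum_symmetrizer_skew mcoeffD mcoeffZ.
  rewrite [X in _ * X + _]mcoeff_one eqxx mulr1 raddf_sum big1 ?addr0 // => x _.
  exact: mcoeff_mul_gen_nil.
have vanish (a b d : K) : b = 0 -> a * b + d = d by move=> ->; rewrite mulr0 add0r.
rewrite vanish; last by rewrite mcoeff_one -size_eq0 size_rev.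
rewrite rev_cons raddf_sum /= -IHys.
under eq_bigr => x _ do rewrite mcoeff_mul_gen.
exact: (sum_delta y
  (fun x => (quantum_symmetrizer c (skew x t))@_(FMonom (rev ys)))).
Qed.

(** The kernel is the largest subspace without constant terms that is stable
    under all skew derivations. *)
Lemma quantum_symmetrizer_eq0 t :
  quantum_symmetrizer c t = 0 <-> forall ys, wcoef ys t = 0.
Proof.
split=> [t0 ys|t0]; first by rewrite -mcoeff_quantum_symmetrizer t0 mcoeff0.
apply/malgP => k; rewrite -(fmK k) -(revK k) mcoeff_quantum_symmetrizer t0.
by rewrite mcoeff0.
Qed.

Lemma quantum_symmetrizer_skew0 x t :
  quantum_symmetrizer c t = 0 -> quantum_symmetrizer c (skew x t) = 0.
Proof.
move=> /quantum_symmetrizer_eq0 t0; apply/quantum_symmetrizer_eq0 => ys.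
exact: (t0 (x :: ys)).
Qed.

(** Left multiplication in a rack is an endomorphism, hence it commutes with the
    recolouring of strands. *)
Lemma quantum_symmetrizer_twist x t :
  quantum_symmetrizer c (twist x t) = twist x (quantum_symmetrizer c t).
Proof.
move: t; apply: linear_ext => [a s t|a s t|w].
- by rewrite twistP quantum_symmetrizerP.
- by rewrite quantum_symmetrizerP twistP.
pose f := tnth (in_tuple w).
have wE : w = [seq f k | k <- enum 'I_(size w)] by rewrite map_tnth_enum.
have -> : quantum_symmetrizer c (word K w) =
    \sum_(y : 'S_(size w)) (-1) ^+ (y : bool) *: word K (colours op y f).
  by rewrite {1}wE quantum_symmetrizer_colours.
rewrite twist_word quantum_symmetrizerZ.
have -> : quantum_symmetrizer c (word K [seq op x z | z <- w]) =
    \sum_(y : 'S_(size w)) (-1) ^+ (y : bool) *: word K (colours op y (op x \o f)).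
  by rewrite {1}wE -map_comp quantum_symmetrizer_colours.
rewrite scaler_sumr linear_sum; apply: eq_bigr => y _.
rewrite /= twistZ twist_word size_colours !scalerA mulrC -map_comp.
congr (_ *: word K _); apply: eq_map => p.
by rewrite /colour /= -act_seq_map // -map_comp.
Qed.

Lemma mcoeff_nilM s t : (s * t)@_(FMonom [::]) = s@_(FMonom [::]) * t@_(FMonom [::]).
Proof.
have -> : FMonom [::] = fmone X by rewrite fmoneE.
exact: rmorphM.
Qed.

Lemma sum_eq0 (a b : K) : a = 0 -> b = 0 -> a + b = 0.
Proof. by move=> -> ->; rewrite addr0. Qed.

(** By the Leibniz rule, the derivatives of a product of some element with an
    element of the kernel are sums of such products, because the kernel is
    stable under skew derivations and twists; and their constant terms are 0. *)
Lemma quantum_symmetrizer_mull s t :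
  quantum_symmetrizer c t = 0 -> quantum_symmetrizer c (s * t) = 0.
Proof.
move=> t0; apply/quantum_symmetrizer_eq0 => ys.
elim: ys s t t0 => [|y ys IHys] s t t0 /=.
  have t00 : t@_(FMonom [::]) = 0 := (quantum_symmetrizer_eq0 t).1 t0 [::].
  by rewrite mcoeff_nilM t00 mulr0.
have twist_t0 : quantum_symmetrizer c (twist y t) = 0.
  by rewrite quantum_symmetrizer_twist t0 raddf0.
rewrite skewM wcoefD; apply: sum_eq0.
  exact: IHys s (skew y t) (quantum_symmetrizer_skew0 y t0).
exact: IHys (skew y s) (twist y t) twist_t0.
Qed.

Lemma quantum_symmetrizer_mulr s t :
  quantum_symmetrizer c s = 0 -> quantum_symmetrizer c (s * t) = 0.
Proof.
move=> s0; apply/quantum_symmetrizer_eq0 => ys.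
elim: ys s t s0 => [|y ys IHys] s t s0 /=.
  have s00 : s@_(FMonom [::]) = 0 := (quantum_symmetrizer_eq0 s).1 s0 [::].
  by rewrite mcoeff_nilM s00 mul0r.
rewrite skewM wcoefD; apply: sum_eq0; first exact: IHys s (skew y t) s0.
exact: IHys (skew y s) (twist y t) (quantum_symmetrizer_skew0 y s0).
Qed.

End SkewDerivations.

(** * The product of the Nichols algebra *)

Section NicholsProduct.
Variables (K : fieldType) (X : finType) (op : X -> X -> X).
Hypothesis opD : forall a b z, op a (op b z) = op (op a b) (op a z).
Local Notation c := (rack_braiding K op).
Local Notation Q := (quantum_symmetrizer c).

Lemma nichols_pi_eq0 t : nichols_pi c t = 0 <-> Q t = 0.
Proof.
have pi0 : nichols_pi c 0 = 0 by exact: raddf0.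
have Q0 : Q 0 = 0 by exact: raddf0.
by have := nichols_pi_eq c t 0; rewrite pi0 Q0.
Qed.

Lemma quantum_symmetrizer_congr s s' t t' :
  Q s = Q s' -> Q t = Q t' -> Q (s * t) = Q (s' * t').
Proof.
have Qsub r r' : Q (r - r') = Q r - Q r' by exact: raddfB.
have sub0 r r' : Q r = Q r' -> Q (r - r') = 0 by rewrite Qsub => ->; rewrite subrr.
have eq_of r r' : Q (r - r') = 0 -> Q r = Q r'.
  by rewrite Qsub => /eqP; rewrite subr_eq0 => /eqP.
move=> /sub0 ss /sub0 tt; transitivity (Q (s' * t)); apply: eq_of.
  by rewrite -mulrBl; apply: quantum_symmetrizer_mulr.
by rewrite -mulrBr; apply: quantum_symmetrizer_mull.
Qed.

Lemma nichols_piM s t :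
  nichols_pi c (s * t) = nichols_mul (nichols_pi c s) (nichols_pi c t).
Proof.
rewrite /nichols_mul; apply/nichols_pi_eq.
by apply: quantum_symmetrizer_congr; apply/nichols_pi_eq; rewrite nichols_reprK.
Qed.

End NicholsProduct.

(** * Ideals given by generators *)

Section GeneratedIdeal.
Variables (A : pzRingType) (S : seq A).
Local Notation I := (in_ideal_gen S).

Lemma in_ideal_gen0 : I 0.
Proof.
exists 0%N, (fun=> 0), (fun=> 0), (fun=> 0).
by split=> [[]//|]; rewrite big_ord0.
Qed.

Lemma in_ideal_genD s t : I s -> I t -> I (s + t).
Proof.
move=> [m [a [r [b [rS ->]]]]] [n [a' [r' [b' [rS' ->]]]]].
pose glue (g : 'I_m -> A) (g' : 'I_n -> A) (i : 'I_(m + n)) :=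
  match fintype.split i with inl j => g j | inr j => g' j end.
have gluel g g' j : glue g g' (lshift n j) = g j by rewrite /glue (unsplitK (inl j)).
have gluer g g' j : glue g g' (rshift m j) = g' j by rewrite /glue (unsplitK (inr j)).
exists (m + n)%N, (glue a a'), (glue r r'), (glue b b'); split=> [i|].
  by rewrite /glue; case: fintype.split.
rewrite big_split_ord; congr (_ + _); apply: eq_bigr => i _.
  by rewrite !gluel.
by rewrite !gluer.
Qed.

Lemma in_ideal_genM x y t : I t -> I (x * t * y).
Proof.
move=> [n [a [r [b [rS ->]]]]].
exists n, (fun i => x * a i), r, (fun i => b i * y); split=> //.
by rewrite mulr_sumr mulr_suml; apply: eq_bigr => i _; rewrite !mulrA.
Qed.

Lemma in_ideal_genMl x t : I t -> I (x * t).
Proof. by move=> It; rewrite -[_ * t]mulr1; apply: in_ideal_genM. Qed.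

Lemma in_ideal_genMr y t : I t -> I (t * y).
Proof. by move=> It; rewrite -[t]mul1r; apply: in_ideal_genM. Qed.

Lemma in_ideal_genN t : I t -> I (- t).
Proof. by move=> It; rewrite -mulN1r; apply: in_ideal_genMl. Qed.

Lemma in_ideal_genB s t : I s -> I t -> I (s - t).
Proof. by move=> Is It; apply: in_ideal_genD => //; apply: in_ideal_genN. Qed.

Lemma mem_in_ideal_gen t : t \in S -> I t.
Proof.
move=> tS; exists 1%N, (fun=> 1), (fun=> t), (fun=> 1); split=> //.
by rewrite big_ord1 mul1r mulr1.
Qed.

End GeneratedIdeal.

(** * The tetrahedral rack and its relations *)

Definition letters : seq 'I_4 := [:: v1; v2; v3; v4].

Lemma mem_letters x : x \in letters.
Proof. by case: x => [[|[|[|[|]]]]]. Qed.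

Lemma letters_all (P : pred 'I_4) : all P letters -> forall x, P x.
Proof. by move=> /allP allP x; apply: allP (mem_letters x). Qed.

Lemma tetra_actD a b z :
  tetra_act a (tetra_act b z) = tetra_act (tetra_act a b) (tetra_act a z).
Proof.
have check : all (fun a => all (fun b => all (fun z =>
  tetra_act a (tetra_act b z) == tetra_act (tetra_act a b) (tetra_act a z))
  letters) letters) letters by vm_compute.
by apply/eqP; exact: (letters_all (letters_all (letters_all check a) b) z).
Qed.

Lemma big_seq_words (V : nmodType) (f : seq 'I_4 -> V) u v w :
  \sum_(z <- [:: u; v; w]) f z = f u + f v + f w.
Proof. by rewrite !big_cons big_nil addr0 addrA. Qed.

(** The relations as lists of words to be summed; all coefficients are 1. *)
Definition tetra_relation_words : seq (seq (seq 'I_4)) :=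
  [:: [:: [:: v1; v1]]; [:: [:: v2; v2]]; [:: [:: v3; v3]]; [:: [:: v4; v4]];
      [:: [:: v3; v1]; [:: v2; v3]; [:: v1; v2]];
      [:: [:: v4; v1]; [:: v3; v4]; [:: v1; v3]];
      [:: [:: v4; v2]; [:: v2; v1]; [:: v1; v4]];
      [:: [:: v4; v3]; [:: v3; v2]; [:: v2; v4]];
      [:: [:: v3; v2; v1; v3; v2; v1]; [:: v2; v1; v3; v2; v1; v3];
          [:: v1; v3; v2; v1; v3; v2]]].

Definition word_sum (K : fieldType) (ws : seq (seq 'I_4)) : {tensalg K['I_4]} :=
  \sum_(w <- ws) word K w.

Lemma word2 (K : fieldType) (x y : 'I_4) : word K [:: x; y] = gen K x * gen K y.
Proof. exact: word_cons. Qed.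

Lemma tetra_relationsE K :
  tetra_relations K = [seq word_sum K ws | ws <- tetra_relation_words].
Proof.
rewrite /tetra_relations /word_sum /= !big_seq1 !big_seq_words.
have square (x : 'I_4) : gen K x ^+ 2 = word K [:: x; x].
  by rewrite expr2 word2.
have triple (x y z t u v : 'I_4) :
    gen K x * gen K y + gen K z * gen K t + gen K u * gen K v
    = word K [:: x; y] + word K [:: z; t] + word K [:: u; v].
  apply: esym; apply: (congr2 +%R); last exact: word2.
  by apply: (congr2 +%R); exact: word2.
have word6 (x1 x2 x3 x4 x5 x6 : 'I_4) :
    gen K x1 * gen K x2 * gen K x3 * gen K x4 * gen K x5 * gen K x6
    = word K [:: x1; x2; x3; x4; x5; x6].
  have mulA6 (A : pzRingType) (a b d e f g : A) :
      a * b * d * e * f * g = a * (b * (d * (e * (f * g)))) by rewrite !mulrA.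
  by rewrite 5!word_cons; exact: mulA6.
do 4!(apply: (congr2 cons); first exact: square).
do 4!(apply: (congr2 cons); first exact: triple).
apply: (congr2 cons) => //; apply: (congr2 +%R); last exact: word6.
by apply: (congr2 +%R); exact: word6.
Qed.

(** Multiply the trinomial relation by y on the left and by x on the right: the
    words y z x and, up to squares, all the others cancel but the two sides of
    the braid relation. *)
Lemma braid_in_ideal (A : pzRingType) (S : seq A) (x y z : A) :
  in_ideal_gen S (x ^+ 2) -> in_ideal_gen S (y ^+ 2) ->
  in_ideal_gen S (z * x + y * z + x * y) ->
  in_ideal_gen S (y * x * y - x * y * x).
Proof.
move=> xx yy r; set t := (X in in_ideal_gen S X) in r.
have -> : y * x * y - x * y * x = y * t - t * x + (z * x ^+ 2 - y ^+ 2 * z).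
  have cancel (V : zmodType) (p q s u w : V) :
      s - w = (p + q + s) - (u + p + w) + (u - q).
    have -> : p + q + s = s + q + p by rewrite addrC [p + q]addrC addrA.
    have -> : u + p + w = p + (w + u).
      by rewrite [u + p]addrC -addrA [u + w]addrC.
    rewrite addrKA -addrA opprD -[- w - u + _]addrA addKr -opprD.
    by rewrite [w + q]addrC addrKA.
  by rewrite /t !mulrDr !mulrDl !expr2 !mulrA; apply: cancel.
apply: in_ideal_genD; apply: in_ideal_genB.
- exact: in_ideal_genMl.
- exact: in_ideal_genMr.
- exact: in_ideal_genMl.
exact: in_ideal_genMr.
Qed.

(** The rule (u, p) stands for u = p, with p a combination of words of the same
    length that precede u in the lexicographic order. The rules for 212 and 323
    do not come directly from a relation; they resolve the overlaps of 31 with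
    the squares 11 and 33. *)
Definition rewrite_rules : seq (seq 'I_4 * seq (int * seq 'I_4)) :=
  [:: ([:: v1; v1], [::]); ([:: v2; v2], [::]); ([:: v3; v3], [::]);
      ([:: v4; v4], [::]);
      ([:: v3; v1], [:: (-1, [:: v2; v3]); (-1, [:: v1; v2])]);
      ([:: v4; v1], [:: (-1, [:: v3; v4]); (-1, [:: v1; v3])]);
      ([:: v4; v2], [:: (-1, [:: v2; v1]); (-1, [:: v1; v4])]);
      ([:: v4; v3], [:: (-1, [:: v3; v2]); (-1, [:: v2; v4])]);
      ([:: v2; v1; v2], [:: (1, [:: v1; v2; v1])]);
      ([:: v3; v2; v3], [:: (1, [:: v2; v3; v2])]);
      ([:: v3; v2; v1; v3; v2; v1],
        [:: (-1, [:: v2; v1; v3; v2; v1; v3]);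
            (-1, [:: v1; v3; v2; v1; v3; v2])])].

Section RulesInIdeal.
Variable K : fieldType.
Local Notation I := (in_ideal_gen (tetra_relations K)).

Definition rule_defect (r : seq 'I_4 * seq (int * seq 'I_4)) : {tensalg K['I_4]} :=
  word K r.1 - combination K r.2.

Lemma rule_defect_monomial u : rule_defect (u, [::]) = word K u.
Proof. by rewrite /rule_defect /combination big_nil subr0. Qed.

Lemma rule_defect_trinomial u v w :
  rule_defect (u, [:: (-1, v); (-1, w)]) = word_sum K [:: u; v; w].
Proof.
rewrite /word_sum big_seq_words /rule_defect /combination.
have expand (V : lmodType K) (f : seq 'I_4 -> V) :
    f u - \sum_(q <- [:: (-1 : int, v); (-1 : int, w)]) q.1%:~R *: f q.2 =
    f u + f v + f w.
  by rewrite !big_cons big_nil addr0 !rmorphN1 !scaleN1r opprD !opprK addrA.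
exact: expand.
Qed.

Lemma rule_defect_binomial u v :
  rule_defect (u, [:: (1, v)]) = word K u - word K v.
Proof. by rewrite /rule_defect /combination big_seq1 scale1r. Qed.

Lemma relation_in_ideal k : (k < size tetra_relation_words)%N ->
  I (word_sum K (nth [::] tetra_relation_words k)).
Proof.
move=> lt_k; apply: mem_in_ideal_gen.
by rewrite tetra_relationsE map_f // mem_nth.
Qed.

Lemma rule_in_ideal r : r \in rewrite_rules -> I (rule_defect r).
Proof.
have rel k (lt_k : (k < 9)%N) := @relation_in_ideal k lt_k.
have sq k w (lt_k : (k < 9)%N) : nth [::] tetra_relation_words k = [:: w] ->
    I (rule_defect (w, [::])).
  move=> wE; rewrite rule_defect_monomial; have := rel k lt_k.
  by rewrite wE /word_sum big_seq1.
have word3 (x y z : 'I_4) : word K [:: x; y; z] = gen K x * gen K y * gen K z.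
  by rewrite 2!word_cons mulrA.
have gens k : (k < 9)%N -> I (nth 0 (tetra_relations K) k).
  by move=> lt_k; apply/mem_in_ideal_gen/mem_nth.
do ![rewrite in_cons => /predU1P[->|]] => //.
- exact: (sq 0%N).
- exact: (sq 1%N).
- exact: (sq 2%N).
- exact: (sq 3%N).
- rewrite rule_defect_trinomial; exact: (rel 4%N).
- rewrite rule_defect_trinomial; exact: (rel 5%N).
- rewrite rule_defect_trinomial; exact: (rel 6%N).
- rewrite rule_defect_trinomial; exact: (rel 7%N).
- rewrite rule_defect_binomial word3 word3.
  apply: (braid_in_ideal (z := gen K v3)).
  - exact: (gens 0%N isT).
  - exact: (gens 1%N isT).
  exact: (gens 4%N isT).
- rewrite rule_defect_binomial word3 word3.
  apply: (braid_in_ideal (z := gen K v1)).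
  - exact: (gens 1%N isT).
  - exact: (gens 2%N isT).
  have rotate (V : zmodType) (a b d : V) : a + b + d = d + a + b.
    by rewrite addrC addrA.
  (* The relation 31 + 23 + 12 is invariant under the cycle 1 -> 2 -> 3 -> 1. *)
  rewrite -rotate; exact: (gens 4%N isT).
rewrite rule_defect_trinomial; exact: (rel 8%N).
Qed.

End RulesInIdeal.

Local Notation tcoef := (icoef tetra_act).

Lemma size_skew_word (X : finType) (op : X -> X -> X) x w q :
  q \in skew_word op x w -> (size q.2).+1 = size w.
Proof.
elim: w q => [|y w IHw] q //=; rewrite mem_cat => /orP[].
  by case: eqP => // _; rewrite mem_seq1 => /eqP->; rewrite size_map.
by case/mapP=> q' /IHw szq' -> /=; rewrite szq'.
Qed.

Lemma icoef_size (X : finType) (op : X -> X -> X) ys w :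
  size ys != size w -> icoef op ys w = 0.
Proof.
elim: ys w => [|y ys IHys] w /=; first by case: w.
move=> neq; have: {in skew_word op y w, forall q, icoef op ys q.2 = 0}.
  by move=> q /size_skew_word szq; apply: IHys; rewrite -eqSS szq.
elim: (skew_word op y w) => //= q p IHp q0.
rewrite q0 ?mem_head // mulr0 add0r; apply: IHp => q' q'p.
by apply: q0; rewrite in_cons q'p orbT.
Qed.

Fixpoint words_of_size n : seq (seq 'I_4) :=
  if n is m.+1 then [seq x :: w | x <- letters, w <- words_of_size m] else [:: [::]].

Lemma mem_words_of_size w : w \in words_of_size (size w).
Proof.
elim: w => // x w IHw; exact: (allpairs_f _ (mem_letters x) IHw).
Qed.

Definition tcoef_sum ys (ws : seq (seq 'I_4)) : int :=
  foldr (fun w m => tcoef ys w + m) 0 ws.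

(** Skew derivatives of order other than the length of a word have no constant
    term, so only the words of that length have to be tried. *)
Definition annihilated (ws : seq (seq 'I_4)) : bool :=
  let n := size (head [::] ws) in
  all (fun w => size w == n) ws &&
  all (fun ys => tcoef_sum ys ws == 0) (words_of_size n).

Lemma tetra_relations_annihilated : all annihilated tetra_relation_words.
Proof. by vm_compute. Qed.

Lemma annihilatedP ws ys : annihilated ws -> tcoef_sum ys ws = 0.
Proof.
rewrite /annihilated; move: (size (head _ _)) => n /andP[/allP size_ws /allP ws0].
have [szE|neq] := eqVneq (size ys) n.
  by apply/eqP/ws0; rewrite -szE mem_words_of_size.
elim: ws {ws0} size_ws => //= w ws IHws size_ws.
rewrite icoef_size ?(eqP (size_ws w _)) ?mem_head // add0r IHws // => u u_ws.
by apply: size_ws; rewrite in_cons u_ws orbT.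
Qed.

Section Relations.
Variable K : fieldType.
Local Notation c := (tetra_braiding K).
Local Notation Q := (quantum_symmetrizer c).
Local Notation I := (in_ideal_gen (tetra_relations K)).
Local Notation kcoef := (@wcoef K _ tetra_act).

Lemma tetra_symmetrizer_eq0 t : Q t = 0 <-> forall ys, kcoef ys t = 0.
Proof. exact: (quantum_symmetrizer_eq0 tetra_actD t). Qed.

Lemma kcoef_word_sum ys ws : kcoef ys (word_sum K ws) = (tcoef_sum ys ws)%:~R.
Proof.
rewrite /word_sum; elim: ws => [|w ws IHws] /=; first by rewrite big_nil raddf0.
by rewrite big_cons wcoefD wcoef_word IHws intrD.
Qed.

Lemma relation_in_kernel t : t \in tetra_relations K -> Q t = 0.
Proof.
rewrite tetra_relationsE => /mapP[ws ws_rel ->].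
apply/tetra_symmetrizer_eq0 => ys; rewrite kcoef_word_sum annihilatedP //.
exact: (allP tetra_relations_annihilated).
Qed.

Lemma ideal_in_kernel t : I t -> Q t = 0.
Proof.
move=> [n [a [r [b [rS ->]]]]]; rewrite linear_sum big1 // => i _.
apply: (quantum_symmetrizer_mulr tetra_actD).
apply: (quantum_symmetrizer_mull tetra_actD).
exact: relation_in_kernel.
Qed.

End Relations.

(** * Normal words span the algebra modulo the relations *)

Definition normal_words : seq (seq 'I_4) :=
  foldr (fun row acc => [seq u ++ v | u <- row, v <- acc]) [:: [::]]
    [:: [:: [::]; [:: v1]]; [:: [::]; [:: v2]; [:: v2; v1]];
        [:: [::]; [:: v3; v2; v1]]; [:: [::]; [:: v3]; [:: v3; v2]];
        [:: [::]; [:: v4]]].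

(** Words read in base 4; on words of equal length this is the lexicographic
    order, and it makes rewriting terminate. *)
Fixpoint word_code (w : seq 'I_4) : nat :=
  if w is x :: w' then (x * 4 ^ size w' + word_code w')%N else 0%N.

Lemma word_code_cat u v :
  word_code (u ++ v) = (word_code u * 4 ^ size v + word_code v)%N.
Proof. by elim: u => //= x u ->; rewrite size_cat expnD mulnDl addnA mulnA. Qed.

Lemma rules_decrease : all (fun r => all (fun q =>
  (size q.2 == size r.1) && (word_code q.2 < word_code r.1)%N) r.2) rewrite_rules.
Proof. by vm_compute. Qed.

(** The induction step of [normal_or_reducible]: as the tail is normal already,
    a rule can only apply at the front. *)
Lemma normal_or_prefix : all (fun w => all (fun x => (x :: w \in normal_words) ||
  has (fun r => prefix r.1 (x :: w)) rewrite_rules) letters) normal_words.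
Proof. by vm_compute. Qed.

Lemma normal_or_reducible w : w \in normal_words \/
  exists2 r, r \in rewrite_rules & exists u v, w = u ++ r.1 ++ v.
Proof.
elim: w => [|x w [w_normal|[r r_rule [u [v ->]]]]]; first by left; vm_compute.
  have := allP (allP normal_or_prefix w w_normal) x (mem_letters x).
  case/orP=> [|/hasP[r r_rule /prefixP[v xwE]]]; first by left.
  by right; exists r => //; exists [::], v.
by right; exists r => //; exists (x :: u), v.
Qed.

Section Spanning.
Variable K : fieldType.
Local Notation I := (in_ideal_gen (tetra_relations K)).
Local Notation m i := (word K (nth [::] normal_words i)).

Definition spanned (t : {tensalg K['I_4]}) : Prop :=
  exists a : 'I_(size normal_words) -> K, I (t - \sum_i a i *: m i).

Lemma in_ideal_genZ a t : I t -> I (a *: t).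
Proof. by move=> /(in_ideal_genMl (a *: 1)); rewrite -scalerAl mul1r. Qed.

Lemma spanned_linear a s t : spanned s -> spanned t -> spanned (a *: s + t).
Proof.
have expand (V : lmodType K) (N : nat) (f : 'I_N -> V) (x y : V) (b d : 'I_N -> K) :
    a *: x + y - \sum_i (a * b i + d i) *: f i =
    a *: (x - \sum_i b i *: f i) + (y - \sum_i d i *: f i).
  under eq_bigr => i _ do rewrite scalerDl -scalerA.
  by rewrite big_split /= -scaler_sumr scalerBr opprD addrACA.
move=> [b sb] [d td]; exists (fun i => a * b i + d i); rewrite expand.
exact: in_ideal_genD (in_ideal_genZ a sb) td.
Qed.

Lemma spanned_normal w : w \in normal_words -> spanned (word K w).
Proof.
move=> w_normal; have lt_w : (index w normal_words < size normal_words)%N.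
  by rewrite index_mem.
exists (fun i => (i == Ordinal lt_w)%:R).
have delta (V : lmodType K) (N : nat) (f : 'I_N -> V) j :
    f j - \sum_i (i == j)%:R *: f i = 0.
  rewrite (bigD1 j) //= eqxx scale1r big1 ?addr0 ?subrr // => i /negbTE->.
  by rewrite scale0r.
have -> : word K w = m (Ordinal lt_w) by rewrite /= nth_index.
rewrite (delta _ _ (fun i => m i)); exact: in_ideal_gen0.
Qed.

Lemma spanned0 : spanned 0.
Proof.
exists (fun=> 0); have zero (V : lmodType K) (N : nat) (f : 'I_N -> V) :
    0 - \sum_i 0 *: f i = 0.
  by rewrite big1 ?subr0 // => i _; rewrite scale0r.
rewrite zero; exact: in_ideal_gen0.
Qed.

Lemma spanned_congr s t : I (s - t) -> spanned t -> spanned s.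
Proof.
move=> Ist [a It]; exists a.
have split3 (V : zmodType) (x y z : V) : x - z = (x - y) + (y - z).
  by rewrite addrA subrK.
by rewrite (split3 _ s t); exact: in_ideal_genD Ist It.
Qed.

Lemma spanned_word w : spanned (word K w).
Proof.
have [n] := ubnP (word_code w); elim: n w => // n IHn w; rewrite ltnS => le_wn.
have [/spanned_normal //|[[l p] lp_rule [u [v wE]]]] := normal_or_reducible w.
rewrite /= in wE.
have sub := in_ideal_genM (word K u) (word K v) (rule_in_ideal K lp_rule).
apply: (@spanned_congr _ (word K u * combination K p * word K v)).
  have -> : word K w = word K u * word K l * word K v.
    by rewrite wE 2!word_cat; exact: mulrA.
  have expand (A : pzRingType) (x y z t : A) : x * y * z - x * t * z = x * (y - t) * z.
    by rewrite mulrBr mulrBl.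
  by rewrite expand.
have := allP rules_decrease _ lp_rule => /allP /= decr.
elim: p decr {lp_rule sub} => [|q p IHp] decr.
  rewrite /combination big_nil mulr0 mul0r; exact: spanned0.
have -> : word K u * combination K (q :: p) * word K v =
   q.1%:~R *: word K (u ++ q.2 ++ v) + word K u * combination K p * word K v.
  rewrite /combination big_cons mulrDr mulrDl; congr (_ + _).
  by rewrite -tensalg_scalerAr -scalerAl 2!word_cat mulrA.
apply: spanned_linear.
  apply: IHn; apply: leq_trans le_wn.
  have [/eqP szq lt_q] := andP (decr q (mem_head _ _)).
  by rewrite wE !word_code_cat !size_cat szq ltn_add2l ltn_add2r ltn_mul2r expn_gt0.
by apply: IHp => q' q'p; apply: decr; rewrite in_cons q'p orbT.
Qed.

Lemma spanned_all t : spanned t.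
Proof.
elim/tensalg_ind: t => [|a w t IHt]; first exact: spanned0.
exact: spanned_linear (spanned_word w) IHt.
Qed.

End Spanning.

(** * Normal words are linearly independent in the Nichols algebra *)

(** The last normal word, of the top degree 9. *)
Definition top_word : seq 'I_4 := [:: v1; v2; v1; v3; v2; v1; v3; v2; v4].

(** Up to a factor 2, the coefficient of [top_word] in the normal form of l m r.
    The test on the length returns early what would be 0 anyway. *)
Definition top_coef l m r : int :=
  let w := l ++ m ++ r in
  if (size w == size top_word)%N then tcoef (rev top_word) w else 0.

Lemma top_coefE l m r : top_coef l m r = tcoef (rev top_word) (l ++ m ++ r).
Proof.
rewrite /top_coef; case: ifP => // /negbT neq.
by rewrite icoef_size // size_rev eq_sym.
Qed.

(** This conditional, like [find] below, stops early, while a conjunction would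
    evaluate both sides; this keeps the search for (l, r) short. *)
Definition separates (ms : seq (seq 'I_4)) m (lr : seq 'I_4 * seq 'I_4) : bool :=
  let: (l, r) := lr in
  if top_coef l m r == 0 then false else all (fun m' => top_coef l m' r == 0) ms.

Fixpoint separated (lrs : seq (seq 'I_4 * seq 'I_4)) (ms : seq (seq 'I_4)) : bool :=
  if ms is m :: ms' then
    (find (separates ms' m) lrs < size lrs)%N && separated lrs ms'
  else true.

(** The matrix of the top coefficients is triangular for a suitable choice of
    two-sided multipliers. *)
Lemma normal_words_separated :
  separated [seq (l, r) | l <- normal_words, r <- normal_words] normal_words.
Proof. by vm_compute. Qed.

Lemma separated_free (K : numFieldType) lrs ms (a : 'I_(size ms) -> K) :
  separated lrs ms ->
  (forall l r, \sum_i a i * (top_coef l (nth [::] ms i) r)%:~R = 0) ->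
  forall i, a i = 0.
Proof.
elim: ms a => [a _ _ []//|m ms IHms] a /= /andP[has_lr sep] a0.
have [[l r] _] : exists2 lr, lr \in lrs & separates ms m lr.
  by apply/hasP; rewrite has_find.
rewrite /separates; case: eqP => // /eqP lmr /allP lm'r.
have a00 : a ord0 = 0.
  have := a0 l r; rewrite big_ord_recl big1 ?addr0 => [/eqP|i _] /=.
    by rewrite mulf_eq0 intr_eq0 (negbTE lmr) orbF => /eqP.
  by rewrite (eqP (lm'r _ (mem_nth [::] (ltn_ord i)))) mulr0.
have a_lift : forall i, a (lift ord0 i) = 0.
  apply: (IHms (fun i => a (lift ord0 i)) sep) => l' r'.
  have := a0 l' r'; rewrite big_ord_recl a00 mul0r add0r => sum0.
  by rewrite -[RHS]sum0; apply: eq_bigr.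
by move=> i; case: (unliftP ord0 i) => [j ->|->].
Qed.

Lemma is_basis_map (K : fieldType) (V : lmodType K) (T : eqType) (z : T)
    (g : T -> V) ms :
  (forall a : 'I_(size ms) -> K,
     \sum_i a i *: g (nth z ms i) = 0 -> forall i, a i = 0) ->
  (forall v, exists a : 'I_(size ms) -> K,
     v = \sum_i a i *: g (nth z ms i)) ->
  is_basis [seq g m | m <- ms].
Proof.
move=> free span; rewrite /is_basis size_map.
have nthE (a : 'I_(size ms) -> K) :
    \sum_i a i *: [seq g m | m <- ms]`_i = \sum_i a i *: g (nth z ms i).
  by apply: eq_bigr => i _; rewrite (nth_map z).
split=> [a|v]; first by rewrite nthE; apply: free.
by have [a ->] := span v; exists a; rewrite nthE.
Qed.

Lemma row_products_words (K : fieldType) (X : choiceType) (rows : seq (seq (seq X))) :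
  row_products [seq [seq word K w | w <- row] | row <- rows] =
  [seq word K w | w <- foldr (fun row acc => [seq u ++ v | u <- row, v <- acc])
                              [:: [::]] rows].
Proof.
rewrite /row_products; elim: rows => [|row rows IHrows] /=.
  by rewrite word_nil.
rewrite IHrows allpairs_mapl allpairs_mapr map_allpairs.
by apply: eq_allpairs => // u v; rewrite word_cat.
Qed.

Lemma tetra_row_products (K : fieldType) :
  row_products (tetra_rows K) = [seq word K w | w <- normal_words].
Proof.
rewrite -row_products_words; congr row_products.
rewrite /tetra_rows /= word_nil.
have row2 (x y : 'I_4) : [:: 1; gen K x; gen K x * gen K y] =
    [:: 1; gen K x; word K [:: x; y]] by rewrite word2.
have row3 (x y z : 'I_4) : [:: 1; gen K x * gen K y * gen K z] =
    [:: 1; word K [:: x; y; z]] by rewrite 2!word_cons mulrA.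
apply: (congr2 cons) => //; apply: (congr2 cons); first exact: row2.
apply: (congr2 cons); first exact: row3.
by apply: (congr2 cons); first exact: row2.
Qed.

(** * The presentation and the basis *)

Section Presentation.
Variable K : numFieldType.
Local Notation c := (tetra_braiding K).
Local Notation Q := (quantum_symmetrizer c).
Local Notation pi := (nichols_pi c).
Local Notation I := (in_ideal_gen (tetra_relations K)).
Local Notation m i := (word K (nth [::] normal_words i)).

Lemma normal_words_free (a : 'I_(size normal_words) -> K) :
  Q (\sum_i a i *: m i) = 0 -> forall i, a i = 0.
Proof.
move=> a0; apply: (separated_free normal_words_separated) => l r.
have := quantum_symmetrizer_mulr tetra_actD (word K r)
  (quantum_symmetrizer_mull tetra_actD (word K l) a0).
move=> /tetra_symmetrizer_eq0/(_ (rev top_word)).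
have -> : word K l * (\sum_i a i *: m i) * word K r =
    \sum_i a i *: word K (l ++ nth [::] normal_words i ++ r).
  rewrite mulr_sumr mulr_suml; apply: eq_bigr => i _.
  by rewrite -tensalg_scalerAr -scalerAl 2!word_cat mulrA.
rewrite wcoef_sum => sum0; rewrite -[RHS]sum0; apply: eq_bigr => i _.
by rewrite wcoefZ wcoef_word -top_coefE.
Qed.

(** Modulo the relations an element of the kernel is a combination of normal
    words, and this combination is in the kernel, hence 0. *)
Lemma kernel_in_ideal t : Q t = 0 -> I t.
Proof.
move=> t0; have [a Ia] := spanned_all t.
have s0 : Q (\sum_i a i *: m i) = 0.
  have := ideal_in_kernel Ia.
  have -> : Q (t - \sum_i a i *: m i) = Q t - Q (\sum_i a i *: m i) by exact: raddfB.
  by move: (Q (\sum_i _)) => s; rewrite t0 sub0r => /eqP; rewrite oppr_eq0 => /eqP.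
have a0 := normal_words_free s0.
suff sum0 : \sum_i a i *: m i = 0 by move: Ia; rewrite sum0 subr0.
by apply: big1 => i _; rewrite a0 scale0r.
Qed.

Lemma pi_eq0 t : pi t = 0 <-> Q t = 0.
Proof. exact: (nichols_pi_eq0 tetra_act t). Qed.

Lemma tetra_presentation :
  [/\ forall s t, pi (s * t) = nichols_mul (pi s) (pi t),
      forall u : nichols c, exists t, pi t = u,
      forall t, pi t = 0 <-> in_ideal_gen (tetra_relations K) t
    & is_basis [seq pi m | m <- row_products (tetra_rows K)]].
Proof.
split.
- exact: (nichols_piM tetra_actD).
- by move=> u; exists (nichols_repr u); apply: nichols_reprK.
- move=> t; split=> [/pi_eq0/kernel_in_ideal //|It].
  exact/pi_eq0/ideal_in_kernel.
rewrite tetra_row_products -map_comp; apply: (is_basis_map (z := [::])) => [a|v] /=.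
  have -> : \sum_i a i *: pi (m i) = pi (\sum_i a i *: m i).
    by rewrite linear_sum; apply: eq_bigr => i _; rewrite linearZ.
  by move=> /pi_eq0/normal_words_free.
rewrite -(nichols_reprK v); have [a Ia] := spanned_all (nichols_repr v).
exists a.
have -> : \sum_i a i *: pi (m i) = pi (\sum_i a i *: m i).
  by rewrite linear_sum; apply: eq_bigr => i _; rewrite linearZ.
have := (pi_eq0 _).2 (ideal_in_kernel Ia).
have -> : pi (nichols_repr v - \sum_i a i *: m i) =
  pi (nichols_repr v) - pi (\sum_i a i *: m i) by exact: raddfB.
by move/eqP; rewrite subr_eq0 => /eqP.
Qed.

End Presentation.

Theorem theorem6p14 (R : realType) :
  let c := tetra_braiding R[i] in
  let pi := nichols_pi c in
  (* [pi] is a surjective algebra morphism whose kernel is generated by the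
     relations *)
  [/\ forall s t, pi (s * t) = nichols_mul (pi s) (pi t),
      forall u : nichols c, exists t, pi t = u,
      forall t, pi t = 0 <-> in_ideal_gen (tetra_relations R[i]) t
    & is_basis [seq pi m | m <- row_products (tetra_rows R[i])]].
Proof. exact: tetra_presentation. Qed.
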